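(* Let $d\in\mathbb N$ and let $\alpha\in\mathbb R^d$ have rationally independent coordinates. Let $R_\alpha:\mathbb T^d\to\mathbb T^d$ be the translation $R_\alpha\omega=\omega+\alpha$. Then $$\mathfrak A(\mathbb T^d,R_\alpha)=\mathbb Z+\alpha\mathbb Z^d=\left\{k_0+\sum_{j=1}^d k_j\alpha_j:k_j\in\mathbb Z\ \text{for all } 0\le j\le d\right\}.$$
   Context: $\mathbb T=\mathbb R/\mathbb Z$, $\mathbb T^d=\mathbb R^d/\mathbb Z^d$; $\alpha$ also denotes its projection to $\mathbb T^d$. The coordinates of $\alpha$ are rationally independent if $\{1,\alpha_1,\dots,\alpha_d\}$ is linearly independent over $\mathbb Q$. In this case $(\mathbb T^d,R_\alpha)$ is uniquely ergodic with invariant measure $\mu$ equal to Lebesgue measure. For a compact metric space $\Omega$, homeomorphism $T:\Omega\to\Omega$ and $T$-ergodic Borel probability measure $\mu$: the suspension is $X=(\Omega\times\mathbb R)/\!\sim$, where $(\omega,t)\sim(\omega',t')$ iff $(\omega',t')=(T^n\omega,t-n)$ for some $n\in\mathbb Z$, with classes $[\omega,t]$, flow $\overline T^{t}[\omega,s]=[\omega,s+t]$, and $\overline T$-ergodic measure $\overline\mu$ given by $\int_X g\,d\overline\mu=\int_0^1\int_\Omega g[\omega,s]\,d\mu(\omega)\,ds$. $C^\sharp(X,\mathbb T)$ is the group of homotopy classes of continuous maps $X\to\mathbb T$ (pointwise addition). For $\phi\in C(X,\mathbb T)$, $x\in X$, let $\widetilde\phi_x:\mathbb R\to\mathbb R$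 be a continuous lift of $t\mapsto\phi(\overline T^{t}x)$. For $\overline\mu$-a.e. $x$, $\lim_{t\to\infty}\widetilde\phi_x(t)/t$ exists and equals a constant depending only on $[\phi]$, denoted $\mathfrak A_{\overline\mu}([\phi])$ (the Schwartzman homomorphism). $\mathfrak A(\Omega,T,\mu)=\mathfrak A_{\overline\mu}(C^\sharp(X,\mathbb T))\subseteq\mathbb R$ is its range; when $(\Omega,T)$ is uniquely ergodic one writes $\mathfrak A(\Omega,T)$. *)

(* Defs.v *)
From HB Require Import structures.
From mathcomp Require Import all_boot all_order all_algebra.
From mathcomp Require Import all_classical all_reals all_analysis.
From mathcomp Require Import measurable_realfun.

Set Implicit Arguments.
Unset Strict Implicit.
Unset Printing Implicit Defensive.

Import Order.TTheory GRing.Theory Num.Theory.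
Import numFieldNormedType.Exports.

Local Open Scope classical_set_scope.
Local Open Scope ring_scope.
Local Open Scope quotient_scope.

Definition int_pred (R : realType) : {pred R} := fun x => x \is a Num.int.

Lemma int_pred_zmod_closed (R : realType) : zmod_closed (@int_pred R).
Proof. by split=> [|x y]; [exact: rpred0|exact: rpredB]. Qed.

HB.instance Definition _ (R : realType) :=
  GRing.isZmodClosed.Build (R : zmodType) (@int_pred R)
    (@int_pred_zmod_closed R).

Definition circle (R : realType) : Type :=
  quotient_topology (Quotient.quot (@int_pred R)).
HB.instance Definition _ (R : realType) := PointedTopological.on (circle R).
HB.instance Definition _ (R : realType) := Quotient.on (circle R).

Definition lattice (R : realType) (d : nat) : {pred 'rV[R]_d} :=
  fun x => x \is a mxOver Num.int.

Lemma lattice_zmod_closed (R : realType) d : zmod_closed (@lattice R d).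
Proof.
split=> [|x y /mxOverP xZ /mxOverP yZ]; apply/mxOverP => i j; rewrite !mxE.
  exact: rpred0.
exact: rpredB.
Qed.

HB.instance Definition _ (R : realType) d :=
  GRing.isZmodClosed.Build 'rV[R]_d (@lattice R d) (@lattice_zmod_closed R d).

Definition torus (R : realType) (d : nat) : Type :=
  quotient_topology (Quotient.quot (@lattice R d)).
HB.instance Definition _ (R : realType) d := PointedTopological.on (torus R d).
HB.instance Definition _ (R : realType) d := Quotient.on (torus R d).
HB.instance Definition _ (R : realType) d :=
  GRing.Zmodule.copy (torus R d) (Quotient.quot (@lattice R d)).

Lemma torus_piD (R : realType) d (x y : 'rV[R]_d) :
  \pi_(torus R d) (x + y) = \pi_(torus R d) x + \pi_(torus R d) y.
Proof. exact: (raddfD (\pi_(Quotient.quot (@lattice R d)))). Qed.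

Record homeo (T : topologicalType) := Homeo {
  homeo_fun :> T -> T;
  homeo_inv : T -> T;
  homeo_continuous : continuous homeo_fun;
  homeo_inv_continuous : continuous homeo_inv;
  homeoK : cancel homeo_fun homeo_inv;
  homeoVK : cancel homeo_inv homeo_fun }.

Definition homeo_iter (T : topologicalType) (f : homeo T) (n : int) : T -> T :=
  match n with
  | Posz k => iter k f
  | Negz k => iter k.+1 (homeo_inv f)
  end.

Section homeo_iter.
Context (T : topologicalType) (f : homeo T).

Lemma homeo_iter1 (n : int) (x : T) :
  homeo_iter f (n + 1) x = f (homeo_iter f n x).
Proof.
case: n => [k|[|k]].
- by rewrite -PoszD addn1.
- by rewrite NegzE addNr /= homeoVK.
- rewrite (_ : Negz k.+1 + 1 = Negz k); first by rewrite /= homeoVK.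
  by rewrite !NegzE -[k.+2]addn1 PoszD opprD addrNK.
Qed.

Lemma homeo_iterN1 (n : int) (x : T) :
  homeo_iter f (n - 1) x = homeo_inv f (homeo_iter f n x).
Proof.
by rewrite -[in RHS](subrK 1 n) homeo_iter1 homeoK.
Qed.

Lemma homeo_iterD (m n : int) (x : T) :
  homeo_iter f (m + n) x = homeo_iter f m (homeo_iter f n x).
Proof.
elim: m => [|m IHm|m IHm]; first by rewrite add0r.
- by rewrite -[m.+1]addn1 PoszD addrAC !homeo_iter1 IHm.
- by rewrite -[m.+1]addn1 PoszD opprD addrAC !homeo_iterN1 IHm.
Qed.

End homeo_iter.

Section suspension.
Context (R : realType) (Omega : ptopologicalType) (f : homeo Omega).

Definition susp_rel : rel (Omega * R) := fun p q =>
  `[< exists n : int, q = (homeo_iter f n p.1, p.2 - n%:~R) >].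

Lemma susp_rel_equiv : equiv_class_of susp_rel.
Proof.
split=> [[w t]|p q|q p r].
- by apply/asboolP; exists 0; rewrite subr0.
- have sym (a b : Omega * R) : susp_rel a b -> susp_rel b a.
    case: a b => [w t] _ /asboolP[n ->]; apply/asboolP; exists (- n).
    by rewrite /= -homeo_iterD addNr mulrNz opprK subrK.
  by apply/idP/idP; exact: sym.
- move=> /asboolP[n ->] /asboolP[m ->]; apply/asboolP; exists (m + n).
  by rewrite /= homeo_iterD intrD opprD (addrC (- m%:~R)) addrA.
Qed.

Canonical susp_rel_equiv_rel := EquivRelPack susp_rel_equiv.

Definition suspension : Type := quotient_topology {eq_quot susp_rel}.
HB.instance Definition _ := Topological.on suspension.
HB.instance Definition _ := Quotient.on suspension.
HB.instance Definition _ := isPointed.Build suspension (\pi_suspension point).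

Definition susp_class (p : Omega * R) : suspension := \pi_suspension p.

(* The choice of representative is immaterial, see susp_flowE. *)
Definition susp_flow (t : R) (x : suspension) : suspension :=
  susp_class ((repr x).1, (repr x).2 + t).

Lemma susp_flowE t w s :
  susp_flow t (susp_class (w, s)) = susp_class (w, s + t).
Proof.
have /asboolP[n] : susp_rel (repr (susp_class (w, s))) (w, s).
  have /eqmodP := reprK (susp_class (w, s)).
  by [].
rewrite /susp_flow; case: (repr _) => [w' s'] /= [-> ->].
apply/eqmodP/asboolP; exists n => /=.
by rewrite addrAC.
Qed.

End suspension.

Definition borel (T : ptopologicalType) : Type := g_sigma_algebraType (@open T).
HB.instance Definition _ (T : ptopologicalType) := Measurable.on (borel T).

Section schwartzman.
Local Open Scope ereal_scope.
Context (R : realType) (Omega : ptopologicalType) (f : homeo Omega).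
Local Notation X := (suspension R f).

(* The measure with int g = int_0^1 int_Omega g[w, s] dmu(w) ds, i.e. the image
   of mu x (Lebesgue measure on [0, 1]) under (w, s) |-> [w, s]; this map is
   Borel measurable when Omega is second countable, in particular when Omega is
   compact metric. *)
Definition susp_measure (mu : probability (borel Omega) R) :
    set (borel X) -> \bar R :=
  pushforward (mu \x uniform_prob (@ltr01 R))
    (@susp_class R Omega f : borel Omega * R -> borel X).

Definition homotopic (Y Z : topologicalType) (g h : Y -> Z) : Prop :=
  exists H : R * Y -> Z,
    [/\ {within `[0%R, 1%R] `*` [set: Y], continuous H},
        forall y, H (0%R, y) = g y & forall y, H (1%R, y) = h y].

Definition homotopy_class (Y Z : topologicalType) (g : Y -> Z) :
    set (Y -> Z) :=
  [set h | continuous h /\ homotopic g h].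

(* Only the underlying set of the group of homotopy classes is needed. *)
Definition Csharp : set (set (X -> circle R)) :=
  [set homotopy_class phi | phi in [set phi | continuous phi]].

Definition is_lift (g : R -> circle R) (F : R -> R) : Prop :=
  continuous F /\ forall t, \pi_(circle R) (F t) = g t.

Definition has_rotation_number (phi : X -> circle R) (x : X) (r : R) : Prop :=
  exists2 F : R -> R, is_lift (fun t => phi (susp_flow t x)) F &
    (F t / t)%R @[t --> +oo%R] --> r.

(* A lift of t |-> phi (susp_flow t x) is unique up to an additive integer, so
   the limit does not depend on it. For an f-ergodic mu on a compact metric
   Omega exactly one r satisfies the condition below; the default value of xget
   is used only outside that case. *)
Definition schwartzman (mu : probability (borel Omega) R)
    (c : set (X -> circle R)) : R :=
  xget 0%R [set r | forall phi, c phi ->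
    {ae susp_measure mu, forall x, has_rotation_number phi x r}].

Definition schwartzman_range (mu : probability (borel Omega) R) : set R :=
  schwartzman mu @` Csharp.

End schwartzman.

Section torus_rotation.
Context (R : realType) (d : nat).

Lemma torus_translation_continuous (a : torus R d) :
  continuous (fun w : torus R d => w + a).
Proof.
rewrite -(reprK a); apply/quotient_continuous.
rewrite (_ : _ \o _ = \pi_(torus R d) \o (fun x => x + repr a)); last first.
  by apply/funext => x /=; rewrite torus_piD.
have c1 : continuous (fun x : 'rV[R]_d => x + repr a).
  by move=> x; exact: (cvgD cvg_id (cvg_cst _)).
have c2 := @pi_continuous _ (Quotient.quot (@lattice R d)).
move=> x; exact: continuous_comp (c1 x) (c2 _).
Qed.

Definition torus_rotation (alpha : 'rV[R]_d) : homeo (torus R d) :=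
  Homeo (@torus_translation_continuous (\pi_(torus R d) alpha))
        (@torus_translation_continuous (- \pi_(torus R d) alpha))
        (addrK _) (subrK _).

End torus_rotation.

Section torus_lebesgue.
Context (R : realType).

Definition tuple_cons n (p : measurableTypeR R * n.-tuple R) : n.+1.-tuple R :=
  [tuple of p.1 :: p.2].

Lemma tuple_cons_measurable n : measurable_fun setT (@tuple_cons n).
Proof. exact: measurable_cons. Qed.

HB.instance Definition _ n := isMeasurableFun.Build _ _ _ _ _
  (@tuple_cons_measurable n).

(* Lebesgue measure on the cube [0, 1]^n, as an iterated product. *)
Fixpoint cube_lebesgue (n : nat) : probability (n.-tuple R) R :=
  match n with
  | 0 => \d_[tuple]
  | n'.+1 => distribution
      (uniform_prob (@ltr01 R) \x cube_lebesgue n')%E (@tuple_cons n')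
  end.

Definition torus_of_tuple d (t : d.-tuple R) : borel (torus R d) :=
  \pi_(torus R d) (\row_i tnth t i).

Lemma open_row_measurable d (O : set 'rV[R]_d) : open O ->
  measurable [set t : d.-tuple R | O (\row_i tnth t i)].
Proof.
move=> oO.
pose box (q : 'rV[rat]_d * nat) : set 'rV[R]_d :=
  [set x | forall i, `|x 0 i - ratr (q.1 0 i)| < q.2.+1%:R^-1].
rewrite (_ : mkset _ = \bigcup_q (if `[< box q `<=` O >] then
    [set t : d.-tuple R | box q (\row_i tnth t i)] else set0)).
  apply: countable_bigcupT_measurable => [|q]; first exact: countableP.
  case: ifPn => // _.
  rewrite (_ : mkset _ = \bigcap_i ((@tnth d R)^~ i @^-1`
      ball (ratr (q.1 0 i) : R) q.2.+1%:R^-1)); last first.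
    apply/seteqP; split=> t /= bt i.
      by move=> _ /=; have := bt i; rewrite mxE /ball/= distrC.
    by have := bt i I; rewrite mxE /ball/= distrC.
  apply: fin_bigcap_measurable => // i _.
  by rewrite -[X in measurable X]setTI; apply: measurable_tnth => //;
    exact: measurable_ball.
apply/seteqP; split=> [t Ot|t [q _]]; last first.
  by case: ifPn => // /asboolP; exact.
have /nbhs_ballP[e /= e0 eO] : nbhs (\row_i tnth t i) O.
  exact: open_nbhs_nbhs.
have [n ne] : exists n : nat, n.+1%:R^-1 < e / 2.
  have [n _ /(_ n (leqnn n))] :=
    near_infty_natSinv_lt (PosNum (divr_gt0 e0 (ltr0n _ 2))).
  by exists n.
have n0 : 0 < (n.+1%:R^-1 : R) by rewrite invr_gt0.
have /choice[q qP] i : exists q : rat, `|tnth t i - ratr q| < n.+1%:R^-1.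
  have /rat_in_itvoo[q] : tnth t i - n.+1%:R^-1 < tnth t i + n.+1%:R^-1.
    by rewrite ltrD2l gtrN.
  rewrite in_itv /= => /andP[q1 q2]; exists q.
  by rewrite distrC ltr_distl q1 q2.
exists (\row_i q i, n) => //; case: ifPn => [_|/asboolP[]] /=.
  by move=> i; rewrite !mxE.
move=> y /= by_; apply: eO; split=> // i j; rewrite ord1 mxE /ball/=.
rewrite -(subrKA (ratr (q j))) (le_lt_trans (ler_normD _ _))//.
rewrite (splitr e) ltrD// (lt_trans _ ne)//.
by have := by_ j; rewrite /= mxE distrC.
Qed.

Lemma torus_of_tuple_measurable d :
  measurable_fun setT (@torus_of_tuple d).
Proof.
apply: (@measurability _ _ _ _ setT (@torus_of_tuple d)
  (@open (torus R d))) => //.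
move=> _ [U oU <-]; rewrite setTI.
exact: (@open_row_measurable d (\pi_(torus R d) @^-1` U)).
Qed.

HB.instance Definition _ d := isMeasurableFun.Build _ _ _ _ _
  (@torus_of_tuple_measurable d).

(* [0, 1]^d is a fundamental domain of Z^d up to a null set, so this image of
   Lebesgue measure on the cube is the translation-invariant probability. *)
Definition torus_lebesgue (d : nat) : probability (borel (torus R d)) R :=
  distribution (cube_lebesgue d) (@torus_of_tuple d).

End torus_lebesgue.

(* Linear independence over rat of the family 1, alpha_1, ..., alpha_d. *)
Definition rationally_independent (R : realType) (d : nat)
    (alpha : 'rV[R]_d) : Prop :=
  forall (q0 : rat) (q : 'I_d -> rat),
    ratr q0 + \sum_(j < d) ratr (q j) * alpha 0 j = 0 ->
    q0 = 0 /\ forall j, q j = 0.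

(* Main.v *)
(* A continuous map phi : X -> T, composed with the covering
   R x R^d -> X, (s, x) |-> [x, s], lifts to a real function F.  The deck
   transformations x |-> x + e_j and (s, x) |-> (s - 1, x + alpha) change F by
   integers c_j and c_0, so F differs by a bounded function from the linear map
   (s, x) |-> sum_j c_j x_j + r s with r = sum_j c_j alpha_j - c_0.  Hence every
   point of X, not just almost every one, has rotation number r.  Lifting a
   whole homotopy shows that the c_j are homotopy invariants.  Conversely
   [x, s] |-> sum_j k_j x_j + r s is well defined on X when
   r = k_0 + sum_j k_j alpha_j, and has rotation number r. *)
Require Import Defs.
From mathcomp Require Import all_boot all_order all_algebra.
From mathcomp Require Import all_classical all_reals all_analysis.
From mathcomp Require Import ring lra.

Import Order.TTheory GRing.Theory Num.Theory.
Import numFieldNormedType.Exports.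

Local Open Scope classical_set_scope.
Local Open Scope ring_scope.

Set Implicit Arguments.
Unset Strict Implicit.

(** * Continuity of composites, pairs and projections *)

Lemma continuousT_comp (T U V : topologicalType) (f : T -> U) (g : U -> V) :
  continuous f -> continuous g -> continuous (g \o f).
Proof. by move=> cf cg x; exact: continuous_comp (cf x) (cg _). Qed.

Lemma continuous_pair (T U V : topologicalType) (f : T -> U) (g : T -> V) :
  continuous f -> continuous g -> continuous (fun x => (f x, g x)).
Proof. by move=> cf cg x; exact: (cvg_pair (cf x) (cg x)). Qed.

Lemma fst_continuous (U V : topologicalType) : continuous (@fst U V).
Proof. by move=> x; exact: cvg_fst. Qed.

Lemma snd_continuous (U V : topologicalType) : continuous (@snd U V).
Proof. by move=> x; exact: cvg_snd. Qed.

(** * Quotients of a normed space by a subgroup *)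

Section quotient_by_subgroup.
Local Open Scope quotient_scope.
Context (R : realType) (V : normedModType R) (G : zmodClosed V).
Local Notation Q := (quotient_topology (Quotient.quot G)).

Lemma quot_pi_eqP (x y : V) : \pi_Q x = \pi_Q y <-> x - y \in G.
Proof. by rewrite (Quotient.idealrBE G); split=> [e|/eqP//]; apply/eqP. Qed.

(** The saturation of [U] is the union of its translates by elements of [G], each of them open. *)
Lemma open_pi (U : set V) : open U -> open (\pi_Q @` U).
Proof.
move=> oU; rewrite /open /= /quotient_open.
rewrite (_ : _ @^-1` _ =
    \bigcup_(k in [set k | k \in G]) ((fun x => x + k) @^-1` U)).
  apply: bigcup_open => k _; apply: open_comp => // x _.
  exact: (cvgD cvg_id (cvg_cst _)).
apply/seteqP; split=> [x [y Uy /quot_pi_eqP yx]|x [k Gk Uxk]].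
  by exists (y - x) => //=; rewrite addrC subrK.
by exists (x + k) => //; apply/quot_pi_eqP; rewrite addrAC subrr add0r.
Qed.

Lemma nbhs_pi (x : V) (U : set V) : nbhs x U -> nbhs (\pi_Q x) (\pi_Q @` U).
Proof.
rewrite !nbhsE => -[W [oW Wx] WU]; exists (\pi_Q @` W); last first.
  exact: image_subset.
by split; [exact: open_pi|exists x].
Qed.

End quotient_by_subgroup.

(** * Signed arcs on the circle *)

Section circle_arcs.
Local Open Scope quotient_scope.
Context (R : realType).
Implicit Types (x y : R) (a b c : circle R).

Lemma circle_eqP x y :
  \pi_(circle R) x = \pi_(circle R) y <-> x - y \is a Num.int.
Proof. exact: (@quot_pi_eqP R R^o (@int_pred R)). Qed.

Lemma nbhs_circle x (U : set R) :
  nbhs x U -> nbhs (\pi_(circle R) x) (\pi_(circle R) @` U).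
Proof. exact: (@nbhs_pi R R^o (@int_pred R)). Qed.

(** The representative of [x] modulo 1 in the interval [-1/2, 1/2). *)
Definition centered x : R := x - (Num.floor (x + 2^-1))%:~R.

Lemma centered_int x : x - centered x \is a Num.int.
Proof. by rewrite /centered opprB addrC subrK intr_int. Qed.

Lemma centered_eq x y : x - y \is a Num.int -> `|y| < 2^-1 -> centered x = y.
Proof.
move=> /intrP[n xy]; rewrite ltr_norml => /andP[y1 y2].
rewrite /centered (_ : Num.floor _ = n); first by lra.
by apply: floor_def; rewrite intrD; apply/andP; split; lra.
Qed.

(** The signed length of the shortest arc from [a] to [b]. It is independent of the representatives,
    since [centered] has period 1. *)
Definition circle_arc a b : R := centered (repr b - repr a).

Lemma pi_arc x b : \pi_(circle R) (x + circle_arc (\pi_(circle R) x) b) = b.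
Proof.
rewrite -[in RHS](reprK b); apply/circle_eqP; rewrite /circle_arc.
set y := repr (\pi_(circle R) x).
have yx : y - x \is a Num.int by apply/circle_eqP; rewrite reprK.
rewrite (_ : _ - _ = - (y - x) - (repr b - y - centered (repr b - y))).
  by rewrite rpredB ?rpredN ?centered_int.
by ring.
Qed.

Lemma circle_arc_eq x y z : \pi_(circle R) y = \pi_(circle R) (x + z) ->
  `|z| < 2^-1 -> circle_arc (\pi_(circle R) x) (\pi_(circle R) y) = z.
Proof.
move=> /circle_eqP yxz z2; apply: centered_eq => //.
have xr : x - repr (\pi_(circle R) x) \is a Num.int.
  by apply/circle_eqP; rewrite reprK.
have yr : repr (\pi_(circle R) y) - y \is a Num.int.
  by apply/circle_eqP; rewrite reprK.
rewrite (_ : _ - z = (repr (\pi_(circle R) y) - y) + (y - (x + z)) +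
  (x - repr (\pi_(circle R) x))); last by ring.
by apply: rpredD => //; apply: rpredD.
Qed.

(** Two displacements below a quarter turn add up to less than a half turn, so their sum does not
    wrap around and [circle_arc_eq] identifies it. *)
Lemma circle_arcD a b c :
  `|circle_arc a b| < 4^-1 -> `|circle_arc b c| < 4^-1 ->
  circle_arc a c = circle_arc a b + circle_arc b c.
Proof.
rewrite -(reprK a) -(reprK b) -(reprK c).
set u := circle_arc _ _; set v := circle_arc _ _ => u4 v4.
apply: circle_arc_eq; last by rewrite (le_lt_trans (ler_normD _ _))//; lra.
have /circle_eqP ub : \pi_(circle R) (repr a + u) = \pi_(circle R) (repr b).
  by rewrite pi_arc reprK.
have /circle_eqP vc : \pi_(circle R) (repr b + v) = \pi_(circle R) (repr c).
  by rewrite pi_arc reprK.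
apply/circle_eqP.
rewrite (_ : _ - _ = - (repr b + v - repr c) - (repr a + u - repr b)).
  by apply: rpredB => //; rewrite rpredN.
by ring.
Qed.

Lemma circle_arcxx a : circle_arc a a = 0.
Proof.
by rewrite /circle_arc subrr; apply: centered_eq; rewrite ?subrr// normr0.
Qed.

(** The arc can jump only at antipodal pairs, which the hypothesis excludes. *)
Lemma circle_arc_continuous a b : `|circle_arc a b| < 2^-1 ->
  {for (a, b), continuous (fun p : circle R * circle R => circle_arc p.1 p.2)}.
Proof.
set t := circle_arc a b => t2; apply/cvgrPdist_lt => /= e e0.
(* Moving each end point by less than [r] changes the displacement by less than [r + r]: at most
   [e], and too little to reach a half turn. *)
pose r := Num.min e (2^-1 - `|t|) / 2.
have t2' : 0 < 2^-1 - `|t| by rewrite subr_gt0.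
have r0 : 0 < r by rewrite divr_gt0// lt_min e0.
have re : r + r <= e by rewrite -splitr ge_min lexx.
have rt : r + r <= 2^-1 - `|t| by rewrite -splitr ge_min lexx orbT.
pose x := repr a.
have ax : a = \pi_(circle R) x by rewrite reprK.
have bx : b = \pi_(circle R) (x + t) by rewrite /t ax pi_arc.
have na := nbhs_circle (nbhsx_ballx x r r0).
have nb := nbhs_circle (nbhsx_ballx (x + t) r r0).
exists (\pi_(circle R) @` ball x r, \pi_(circle R) @` ball (x + t) r).
  by rewrite /= [in nbhs a _]ax [in nbhs b _]bx; split.
move=> [_ _] /= [[x' xx' <-] [y' yy' <-]].
rewrite /ball/= !ltr_norml in xx' yy'.
move/andP: xx' => [? ?]; move/andP: yy' => [? ?].
have tt : `|t - (y' - x')| < r + r.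
  by rewrite ltr_norml; apply/andP; split; lra.
rewrite (@circle_arc_eq _ _ (y' - x')); first exact: lt_le_trans re.
  by rewrite addrC subrK.
rewrite (_ : y' - x' = t - (t - (y' - x'))); last by ring.
rewrite (le_lt_trans (ler_normB _ _))//; lra.
Qed.

End circle_arcs.

(** * Lifting circle-valued maps on a normed space *)

Section lifting.
Local Open Scope quotient_scope.
Context (R : realType) (E : normedModType R) (g : E -> circle R).
Context (cg : continuous g).

(** The lift is built along the segment from 0 to [y]. Dyadic subdivisions are nested, and the
    quarter bound in [fine] is what lets [circle_arcD] merge adjacent arcs. *)
Let dyadic (n i : nat) : R := i%:R / 2 ^+ n.

Let darc n i (y : E) : R :=
  circle_arc (g (dyadic n i *: y)) (g (dyadic n i.+1 *: y)).

Let arcs n (y : E) : R := \sum_(i < 2 ^ n) darc n i y.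

Let fine n (y : E) := forall i : nat, (i < 2 ^ n)%N -> `|darc n i y| < 4^-1.

Let dyadic_double n i : dyadic n.+1 i.*2 = dyadic n i.
Proof. by rewrite /dyadic -mul2n natrM exprS; field. Qed.

(* Once adjacent dyadic points of the ray to [y] have close images, refining
   the subdivision no longer changes the sum of the arcs. *)
Let arcs_fine n y : fine n.+1 y -> arcs n.+1 y = arcs n y.
Proof.
move=> fy; rewrite /arcs expnS mul2n.
have H m : (m <= 2 ^ n)%N ->
    \sum_(i < m.*2) darc n.+1 i y = \sum_(i < m) darc n i y.
  elim: m => [|m IHm] mn; first by rewrite !big_ord0.
  rewrite doubleS !big_ord_recr /= IHm ?(ltnW mn)// -addrA; congr (_ + _).
  rewrite /darc -(dyadic_double n m) -(dyadic_double n m.+1) doubleS.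
  rewrite -circle_arcD//; apply: fy.
    by rewrite expnS mul2n ltn_double.
  by rewrite expnS mul2n -doubleS leq_double.
exact: H.
Qed.

(** True at every level, fine or not: each arc leads exactly from one image point to the next. *)
Let pi_arcs n y : \pi_(circle R) (repr (g 0) + arcs n y) = g y.
Proof.
have H m : \pi_(circle R) (repr (g 0) + \sum_(i < m) darc n i y) =
    g (dyadic n m *: y).
  elim: m => [|m IHm].
    by rewrite big_ord0 addr0 reprK /dyadic mul0r scale0r.
  by rewrite big_ord_recr /= addrA /darc -IHm pi_arc.
by rewrite H /dyadic natrX divff ?scale1r// expf_neq0.
Qed.

(** Compactness of the segment gives one level that works for all [y] near [y0], so that the lift is
    locally a single finite sum. *)
Let near_fine (y0 : E) : exists n0 : nat, \forall y \near y0, forall n,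
  (n0 <= n)%N -> fine n y.
Proof.
(* The pair [q] is a point [y] with a modulus of continuity; the near-covering form of compactness
   is applied with the modulus tending to 0 from the right. *)
pose P (q : E * R) (s : R) := forall s', `|s' - s| < q.2 ->
  `|circle_arc (g (s *: q.1)) (g (s' *: q.1))| < 4^-1.
have /compact_near_coveringP nc := @segment_compact R 0 1.
have [s _|[U V] /= [Uy V0] UV] := nc _ (filter_prod (nbhs y0) (0:R)^'+) P _.
  set a := g (s *: y0).
  have [[W1 W2] /= [W1a W2a] W12] :
      nbhs (a, a) [set p | `|circle_arc p.1 p.2| < 4^-1].
    have /cvgrPdist_lt/(_ 4^-1) : {for (a, a), continuous
        (fun p : circle R * circle R => circle_arc p.1 p.2)}.
      by apply: circle_arc_continuous; rewrite circle_arcxx normr0 invr_gt0.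
    rewrite invr_gt0 ltr0n => /(_ isT); apply: filterS => p /=.
    by rewrite circle_arcxx sub0r normrN.
  have cs : {for (s, y0), continuous (fun p : R^o * E => g (p.1 *: p.2))}.
    apply: continuous_comp; first exact: scale_continuous.
    exact: cg.
  have [[A B] /= [As By] AB] := cs _ (filterI W1a W2a).
  have [e /= e0 eA] : exists2 e : R, 0 < e & ball s e `<=` A.
    by move/nbhs_ballP : As => [e /= e0 eA]; exists e.
  (* With [s1] within [e / 2] of [s] and [s2] within [e / 2] of [s1], both parameters remain in
     [A]. *)
  have e20 : 0 < e / 2 by rewrite divr_gt0.
  exists (ball s (e / 2), B `*` [set d | d < e / 2]).
    split; first exact: nbhsx_ballx.
    exists (B, [set d | d < e / 2]) => //.
    by split => //; exact: nbhs_right_lt.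
  move=> [s1 [y d]] /= [s1s [Bs de]] s2 s2s1 /=.
  rewrite /ball/= in s1s.
  apply: (W12 (_, _)); split; [apply: (AB (s1, y) _).1|apply: (AB (s2, y) _).2].
    split => //=; apply: eA; rewrite /ball/=; lra.
  split => //=; apply: eA; rewrite /ball/= (splitr e).
  rewrite (_ : s - s2 = (s - s1) - (s2 - s1)); last by ring.
  by rewrite (le_lt_trans (ler_normB _ _))// ltrD// (lt_trans s2s1).
have [d [/= d0 Vd]] : exists d, 0 < d /\ V d.
  near (0:R)^'+ => d; exists d; split; near: d => //.
  exact: nbhs_right_gt.
have [n0 _ n0d] := near_infty_natSinv_expn_lt (PosNum d0).
exists n0; near=> y => n n0n i i2n.
have yU : U y by near: y.
apply: (UV (y, d)) => //=.
- rewrite in_itv/= /dyadic divr_ge0 ?exprn_ge0//= ler_pdivrMr ?exprn_gt0//.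
  by rewrite mul1r -natrX ler_nat ltnW.
- rewrite /dyadic -mulrBl -natrB// subSnn ger0_norm.
    exact: n0d.
  by rewrite divr_ge0 ?exprn_ge0//.
Unshelve. all: by end_near.
Qed.

(** The limit exists because the sequence is eventually constant; taking it avoids choosing a level
    for each [y]. *)
Definition circle_lift (y : E) : R := repr (g 0) + lim (arcs n y @[n --> \oo]).

Let near_lift (y0 : E) : exists n : nat, fine n y0 /\
  \forall y \near y0, circle_lift y = repr (g 0) + arcs n y.
Proof.
have [n0 n0f] := near_fine y0; exists n0; split.
  by move/nbhs_singleton : n0f; exact.
apply: filterS n0f => y fy; rewrite /circle_lift; congr (_ + _).
apply: cvg_lim => //; apply: cvg_near_cst; exists n0 => // n /= n0n.
elim: n n0n => [|n IHn]; first by rewrite leqn0 => /eqP ->.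
rewrite leq_eqVlt => /predU1P[->//|n0n].
by rewrite arcs_fine ?IHn//; exact/fy/ltnW.
Qed.

(** Near [y0] the lift is a sum of arcs at a fixed level, all short enough at [y0] for
    [circle_arc_continuous]. *)
Lemma circle_lift_continuous : continuous circle_lift.
Proof.
move=> y0; have [n [fn nl]] := near_lift y0.
rewrite /continuous_at (nbhs_singleton nl).
apply: cvg_trans (near_eq_cvg _) _; last first.
- apply: cvgD; first exact: cvg_cst.
  apply: cvg_big => [|i _]; first exact: add_continuous.
  have i4 : `|darc n i y0| < 2^-1 by have := fn i (ltn_ord i); lra.
  have cz z : g (z *: y) @[y --> y0] --> g (z *: y0).
    exact: (cvg_comp _ _ (@scaler_continuous R E z y0) (cg (x:=_))).
  exact: (cvg_comp _ _ (cvg_pair (cz _) (cz _)) (circle_arc_continuous i4)).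
- by apply: filterS nl => y ->.
Qed.

Lemma pi_circle_lift y : \pi_(circle R) (circle_lift y) = g y.
Proof.
by have [n [_ /nbhs_singleton ->]] := near_lift y; rewrite pi_arcs.
Qed.

End lifting.

(** * Uniqueness of lifts and of rotation numbers *)

Lemma int_valued_continuous_cst (R : realType) (E : normedModType R)
  (f : E -> R) : continuous f -> (forall x, f x \is a Num.int) ->
  forall x y, f x = f y.
Proof.
move=> cf fint.
have lt_false x y : f x < f y -> False.
  move=> fxy; pose h (t : R) := f (x + t *: (y - x)).
  have ch : continuous h.
    move=> t; rewrite /h.
    apply: (@continuous_comp _ _ _ (fun t : R => x + t *: (y - x)) f);
      last exact: cf.
    apply: cvgD; first exact: cvg_cst.
    exact: (@scalel_continuous R E (y - x) t).
  have h0 : h 0 = f x by rewrite /h scale0r addr0.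
  have h1 : h 1 = f y by rewrite /h scale1r addrC subrK.
  have gap : f x + 1 <= f y.
    have /intrP[m xm] := fint x; have /intrP[n yn] := fint y.
    by move: fxy; rewrite xm yn -(intrD _ m 1) ltr_int ler_int lezD1.
  (* Along the segment from [x] to [y] the function would have to take a value halfway between two
     integers. *)
  have [|c _ hc] := @IVT R h 0 1 (f x + 2^-1) ler01 (continuous_subspaceT ch).
    by rewrite h0 h1 min_l ?max_r//; lra.
  have : (2^-1 : R) \is a Num.int.
    rewrite (_ : 2^-1 = h c - f x); last by rewrite hc; ring.
    by apply: rpredB; exact: fint.
  move=> /intrP[m m2].
  have m0 : (0 < m)%R by rewrite -(ltr0z R) -m2; lra.
  have m1 : (m < 1)%R by rewrite -(ltr_int R) -m2; lra.
  by move: m0; rewrite -lezD1 add0r leNgt m1.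
by move=> x y; case: (ltgtP (f x) (f y)) => // /lt_false.
Qed.

Lemma cvg_div_id (R : realType) (f : R -> R) (r M : R) :
  (forall t, `|f t - r * t| <= M) -> f t / t @[t --> +oo] --> r.
Proof.
move=> fM; apply/cvgrPdist_lt => /= e e0; near=> t.
have t0 : 0 < t by near: t; apply: nbhs_pinfty_gt; exact: num_real.
rewrite (_ : r - f t / t = - ((f t - r * t) / t)); last first.
  by field; rewrite gt_eqF.
rewrite normrN normrM normfV (gtr0_norm t0) ltr_pdivrMr//.
apply: le_lt_trans (fM t) _; rewrite mulrC -ltr_pdivrMr//.
by near: t; apply: nbhs_pinfty_gt; exact: num_real.
Unshelve. all: by end_near.
Qed.

Lemma period_mulrz (V : zmodType) (T : Type) (B : V -> T) (v : V) :
  (forall y, B (y + v) = B y) -> forall (n : int) y, B (y + v *~ n) = B y.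
Proof.
move=> Bv; elim=> [|n IHn|n IHn] y; first by rewrite mulr0z addr0.
  by rewrite -addn1 PoszD mulrzDr addrA Bv IHn.
by rewrite -addn1 PoszD opprD mulrzDr addrA mulrN1z -Bv subrK IHn.
Qed.

Lemma lift_unique (R : realType) (g : R -> circle R) (F G : R -> R) :
  is_lift g F -> is_lift g G -> forall t, F t - G t = F 0 - G 0.
Proof.
move=> [cF piF] [cG piG] t.
apply: (@int_valued_continuous_cst R R^o (fun t => F t - G t)) => [s|s].
  exact: cvgB (cF s) (cG s).
by apply/circle_eqP; rewrite piF piG.
Qed.

(** Two lifts along the same orbit differ by a constant, which vanishes in the limit after division
    by [t]. *)
Lemma rotation_number_unique (R : realType) (Omega : ptopologicalType)
  (f : homeo Omega) (phi : suspension R f -> circle R) (x : suspension R f)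
  (r r' : R) :
  has_rotation_number phi x r -> has_rotation_number phi x r' -> r = r'.
Proof.
move=> [F lF Fr] [G lG Gr'].
have FG : (F t - G t) / t @[t --> +oo] --> 0.
  apply: (@cvg_div_id _ _ _ `|F 0 - G 0|) => t.
  by rewrite mul0r subr0 (lift_unique lF lG).
have FGr : (F t - G t) / t @[t --> +oo] --> r - r'.
  under eq_cvg do rewrite mulrBl.
  exact: cvgB.
apply/eqP; rewrite -subr_eq0; apply/eqP.
by rewrite -(cvg_lim _ FGr)// -(cvg_lim _ FG).
Qed.

(** Serves to extend a homotopy, continuous only within the unit interval of parameters, to all real
    parameters by clamping. *)
Lemma within_continuous_compose (X Y Z : topologicalType) (A : set Y)
  (h : X -> Y) (k : Y -> Z) : continuous h -> (forall x, A (h x)) ->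
  {within A, continuous k} -> continuous (k \o h).
Proof.
move=> ch Ah /subspace_continuousP ck x.
apply: cvg_trans (ck _ (Ah x)) => P /= /(ch x).
rewrite /nbhs /= => WP.
by apply: filterS WP => z /= /(_ (Ah z)).
Qed.

(** * Growth of functions with constant increments under a lattice *)

(** The slope [r] solves [l alpha - r = c0], so the linear map [l x + r * s] has the same increments
    as [F] and stays at bounded distance from it. *)
Lemma quasiperiodic_slope (R : realType) (d : nat) (alpha c : 'rV[R]_d) (c0 : R)
    (F : R * 'rV[R]_d -> R) :
  continuous F ->
  (forall j s x, F (s, x + delta_mx 0 j) = F (s, x) + c 0 j) ->
  (forall s x, F (s - 1, x + alpha) = F (s, x) + c0) ->
  forall s x, F (s + t, x) / t @[t --> +oo] -->
    \sum_(j < d) c 0 j * alpha 0 j - c0.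
Proof.
move=> cF Fj F0; set r := _ - c0.
pose l (x : 'rV[R]_d) := \sum_(j < d) c 0 j * x 0 j.
have lD x y : l (x + y) = l x + l y.
  by rewrite /l -big_split/=; apply: eq_bigr => j _; rewrite mxE mulrDr.
have le j : l (delta_mx 0 j) = c 0 j.
  rewrite /l (bigD1 j)//= big1 ?addr0 => [|i ij]; rewrite mxE eqxx.
    by rewrite eqxx mulr1.
  by rewrite (negbTE ij) mulr0.
(* [B] is invariant under a cocompact lattice, hence bounded. *)
pose B (p : R * 'rV[R]_d) := F p - l p.2 - r * p.1.
have Bj j s x : B (s, x + delta_mx 0 j) = B (s, x).
  by rewrite /B /= Fj lD le; ring.
have BZ (k : 'I_d -> int) s x :
    B (s, x + \sum_(j < d) delta_mx 0 j *~ k j) = B (s, x).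
  move: x; pose P w := forall x, B (s, x + w) = B (s, x).
  apply: (big_ind P) => [x|v w Pv Pw x|j _]; first by rewrite addr0.
    by rewrite addrA Pw Pv.
  exact: (@period_mulrz _ _ (fun x => B (s, x))).
have BA (n : int) s x : B (s - n%:~R, x + alpha *~ n) = B (s, x).
  pose B' (m : int) := B (s - m%:~R, x + alpha *~ m).
  have B'1 m : B' (m + 1) = B' m.
    rewrite /B' !mulrzDr mulr1z opprD !addrA /B /= F0 !lD /r -/(l alpha).
    by ring.
  have := period_mulrz B'1 n 0; rewrite add0r intz /B' => ->.
  by rewrite subr0 mulr0z addr0.
have cB : continuous B.
  move=> p; apply: cvgB; first apply: cvgB; first exact: cF.
    apply: (@cvg_big R _ +%R 0 xpredT (@add_continuous R)) => j _.
    apply: cvgM; first exact: cvg_cst.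
    apply: (@continuous_comp _ _ _ snd (fun v : 'rV[R]_d => v 0 j) p).
      exact: cvg_snd.
    exact: coord_continuous.
  by apply: cvgM; [exact: cvg_cst|exact: cvg_fst].
have [M BM] : exists M, forall p, `|B p| <= M.
  pose K := `[0 : R, 1]%classic `*`
    [set v : 'rV[R]_d | forall i, `[0 : R, 1]%classic (v ord0 i)].
  have cK : compact K.
    apply: compact_setX; first exact: segment_compact.
    apply: (@rV_compact R d (fun=> `[0 : R, 1]%classic)) => i.
    exact: segment_compact.
  have /compact_bounded[M [_ MB]] : compact (B @` K).
    by apply: continuous_compact => //; exact: continuous_subspaceT.
  (* [compact_bounded] yields bounds strictly above [M] only, whence [M + 1]. *)
  exists (M + 1) => -[s x].
  (* First [n] steps of the skew translation bring the time into the unit interval; integer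
     translations then bring the space coordinates into the unit cube. *)
  pose n := Num.floor s; pose y := x + alpha *~ n.
  rewrite -(BA n) -(BZ (fun j => - Num.floor (y 0 j))).
  apply: (MB (M + 1)); first by rewrite ltrDl.
  exists (s - n%:~R, y + \sum_(j < d) delta_mx 0 j *~ - Num.floor (y 0 j));
    last by [].
  have frac z : `[0 : R, 1]%classic (z - (Num.floor z)%:~R).
    have := floorD1_gt z; rewrite intrD => z1; have := Num.Theory.floor_le z.
    by rewrite /= in_itv /=; lra.
  split => /=; first exact: frac.
  move=> i; rewrite mxE summxE (bigD1 i)//= big1 => [|j /negbTE ji].
    by rewrite addr0 -scaler_int !mxE !eqxx mulr1 rmorphN; exact: frac.
  by rewrite -scaler_int !mxE eqxx [i == j]eq_sym ji mulr0.
move=> s x; apply: (@cvg_div_id _ _ _ (M + `|l x + r * s|)) => t.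
rewrite (_ : _ - _ = B (s + t, x) + (l x + r * s)); last by rewrite /B /=; ring.
by rewrite (le_trans (ler_normD _ _))// lerD2r.
Qed.

(** * The covering of the suspension by a vector space *)

Section torus_suspension.
Local Open Scope quotient_scope.
Context (R : realType) (d : nat) (alpha : 'rV[R]_d).
Local Notation f := (torus_rotation alpha).
Local Notation X := (suspension R f).

(** Its source is a normed space, where [circle_lift] is available, and it turns the flow into
    translation of the first coordinate. *)
Definition susp_cover (p : R * 'rV[R]_d) : X :=
  susp_class f (\pi_(torus R d) p.2, p.1).

Lemma susp_cover_continuous : continuous susp_cover.
Proof.
apply: (continuousT_comp _ (@pi_continuous _ {eq_quot susp_rel f})).
apply: continuous_pair; last exact: fst_continuous.
apply: (continuousT_comp (@snd_continuous _ _)).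
exact: (@pi_continuous _ (Quotient.quot (@lattice R d))).
Qed.

Lemma susp_coverP (x : X) : exists p, x = susp_cover p.
Proof.
exists ((repr x).2, repr (repr x).1).
by rewrite /susp_cover /= reprK -surjective_pairing /susp_class reprK.
Qed.

Lemma susp_flow_cover (t s : R) (x : 'rV[R]_d) :
  susp_flow t (susp_cover (s, x)) = susp_cover (s + t, x).
Proof. exact: susp_flowE. Qed.

Lemma susp_cover_delta j s x :
  susp_cover (s, x + delta_mx 0 j) = susp_cover (s, x).
Proof.
congr (susp_class f (_, _)) => /=.
apply/(@quot_pi_eqP R 'rV[R]_d (@lattice R d)).
rewrite addrAC subrr add0r; apply/mxOverP => i k; rewrite mxE.
by case: (_ && _).
Qed.

Lemma susp_cover_translate s x :
  susp_cover (s - 1, x + alpha) = susp_cover (s, x).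
Proof.
apply/esym/eqmodP/asboolP; exists 1.
by rewrite /= torus_piD.
Qed.

End torus_suspension.

(** * Rotation numbers of homotopic maps *)

Section rotation_numbers.
Local Open Scope quotient_scope.
Context (R : realType) (d : nat) (alpha : 'rV[R]_d).
Local Notation f := (torus_rotation alpha).
Local Notation X := (suspension R f).

(** Lifting the homotopy as a whole gives both ends the same integers. A single map is covered by
    its constant homotopy. *)
Lemma homotopic_rotation_number (phi psi : X -> circle R) :
  homotopic R phi psi -> exists k0 (k : 'I_d -> int),
    let r := k0%:~R + \sum_(j < d) (k j)%:~R * alpha 0 j in
    forall x, has_rotation_number phi x r /\ has_rotation_number psi x r.
Proof.
move=> [H [cH H0 H1]].
pose clamp (u : R) := Num.max 0 (Num.min u 1).
have clamp01 u : 0 <= clamp u <= 1.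
  by rewrite /clamp le_max lexx ge_max ler01 ge_min lexx orbT.
have clamp_cont : continuous clamp.
  move=> u; apply: (@continuous_max R R^o (fun=> 0) (fun u => Num.min u 1)).
    exact: cvg_cst.
  apply: (@continuous_min R R^o id (fun=> 1)); first exact: cvg_id.
  exact: cvg_cst.
pose g (p : R * (R * 'rV[R]_d)) := H (clamp p.1, susp_cover alpha p.2).
have cg : continuous g.
  apply: (within_continuous_compose _ _ cH).
    apply: continuous_pair.
      exact: (continuousT_comp (@fst_continuous _ _) clamp_cont).
    exact: (continuousT_comp (@snd_continuous _ _)
      (@susp_cover_continuous R d alpha)).
  by move=> p; split => //=; rewrite in_itv; exact: clamp01.
pose L := circle_lift g.
have cL : continuous L by exact: circle_lift_continuous.
have piL p : \pi_(circle R) (L p) = g p by exact: pi_circle_lift.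
(* Deck transformations change the lift by an integer; by continuity it is the
   same at both ends of the homotopy. *)
have deck (a : R) (v : 'rV[R]_d) :
    (forall s x, susp_cover alpha (s + a, x + v) = susp_cover alpha (s, x)) ->
    exists n : int, forall u s x, L (u, (s + a, x + v)) = L (u, (s, x)) + n%:~R.
  move=> cover_av.
  pose h (p : R * (R * 'rV[R]_d)) := (p.1, (p.2.1 + a, p.2.2 + v)).
  have hint p : L (h p) - L p \is a Num.int.
    apply/circle_eqP; rewrite !piL /g /= cover_av.
    by case: p => u [s x].
  have ch : continuous h.
    apply: continuous_pair; first exact: fst_continuous.
    apply: continuous_pair => p.
      apply: cvgD; last exact: cvg_cst.
      exact: (cvg_comp _ _ (snd_continuous (x:=p)) (fst_continuous (x:=p.2))).
    apply: cvgD; last exact: cvg_cst.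
    exact: (cvg_comp _ _ (snd_continuous (x:=p)) (snd_continuous (x:=p.2))).
  have cLh : continuous (fun p => L (h p) - L p).
    by move=> p; apply: cvgB (cL p); exact: (continuousT_comp ch cL).
  have /intrP[n n0] := hint 0; exists n => u s x.
  have := int_valued_continuous_cst cLh hint (u, (s, x)) 0.
  by rewrite n0 => <-; rewrite [RHS]addrC subrK.
have /choice[k kP] j : exists n : int, forall u s x,
    L (u, (s, x + delta_mx 0 j)) = L (u, (s, x)) + n%:~R.
  have [s x|n nP] := deck 0 (delta_mx 0 j).
    by rewrite addr0 susp_cover_delta.
  by exists n => u s x; rewrite -nP addr0.
have [k0 k0P] := deck (- 1) alpha (@susp_cover_translate _ _ _).
(* The deck transformation lowers the time by 1, so its increment [k0] enters the slope with a minus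
   sign. *)
exists (- k0), k => r.
have rot u x : has_rotation_number (fun x => H (clamp u, x)) x r.
  have [[s v] ->] := susp_coverP x.
  exists (fun t => L (u, (s + t, v))).
    split; last by move=> t; rewrite piL susp_flow_cover.
    apply: (@continuousT_comp _ _ _ (fun t => (u, (s + t, v))) _ _ cL).
    apply: continuous_pair => [t|]; first exact: cvg_cst.
    apply: continuous_pair => [t|t]; last exact: cvg_cst.
    by apply: cvgD; [exact: cvg_cst|exact: cvg_id].
  have -> : r = \sum_(j < d) (\row_j (k j)%:~R) 0 j * alpha 0 j - k0%:~R.
    rewrite /r rmorphN addrC; congr (_ - _).
    by apply: eq_bigr => j _; rewrite mxE.
  apply: (@quasiperiodic_slope R d alpha _ _ (fun p => L (u, p))).
  - apply: (@continuousT_comp _ _ _ (pair u) _ _ cL).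
    by apply: continuous_pair => p; [exact: cvg_cst|exact: cvg_id].
  - by move=> j s' x'; rewrite kP mxE.
  - exact: k0P.
have E0 : (fun x => H (clamp 0, x)) = phi.
  by apply/funext => x; rewrite /clamp min_l ?ler01// max_l// H0.
have E1 : (fun x => H (clamp 1, x)) = psi.
  by apply/funext => x; rewrite /clamp min_l// max_r// H1.
by move=> x; split; [rewrite -E0|rewrite -E1].
Qed.

End rotation_numbers.

(** * From pointwise rotation numbers to the Schwartzman value *)

Section schwartzman_value.
Context (R : realType) (Omega : ptopologicalType) (f : homeo Omega).
Context (mu : probability (borel Omega) R).
Local Notation X := (suspension R f).

Lemma susp_ae_all (P : X -> Prop) :
  (forall x, P x) -> {ae @susp_measure R Omega f mu, forall x, P x}.
Proof.
move=> aP; exists set0; split; first exact: measurable0.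
  by rewrite /susp_measure /pushforward preimage_set0 measure0.
by move=> x /=; apply; exact: aP.
Qed.

Lemma susp_ae_ex (P : X -> Prop) :
  {ae @susp_measure R Omega f mu, forall x, P x} -> exists x, P x.
Proof.
move=> [A [mA A0 PA]]; apply: contrapT => /forallNP nP.
have AT : A = setT by apply/seteqP; split => // x _; exact/PA/nP.
move: A0; rewrite AT /susp_measure /pushforward preimage_setT probability_setT.
by move/eqP; rewrite onee_eq0.
Qed.

Lemma homotopy_class_refl (phi : X -> circle R) :
  continuous phi -> homotopy_class R phi phi.
Proof.
move=> cphi; split => //; exists (phi \o snd); split => //.
apply: continuous_subspaceT; exact: continuousT_comp (@snd_continuous _ _) cphi.
Qed.

(** The number picked by [xget] and [r] are both rotation numbers of [phi] at some common point,
    since a property true almost everywhere for a measure of mass 1 holds somewhere. *)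
Lemma schwartzman_eq (phi : X -> circle R) (r : R) : continuous phi ->
  (forall psi, homotopy_class R phi psi ->
    forall x, has_rotation_number psi x r) ->
  schwartzman mu (homotopy_class R phi) = r.
Proof.
move=> cphi phir; rewrite /schwartzman.
set P := mkset _.
(* As [r] qualifies, [xget] does not return its default value. *)
have Pr : P r by move=> psi /phir psir; exact: susp_ae_all.
have [x xP] :=
  susp_ae_ex (xgetPex 0 (ex_intro _ _ Pr) _ (homotopy_class_refl cphi)).
apply: rotation_number_unique xP _; exact/phir/homotopy_class_refl.
Qed.

End schwartzman_value.

(** * Linear maps realizing every candidate value *)

Section linear_maps.
Local Open Scope quotient_scope.
Context (R : realType) (d : nat) (alpha : 'rV[R]_d).
Context (k0 : int) (k : 'I_d -> int).
Local Notation f := (torus_rotation alpha).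
Local Notation X := (suspension R f).
Let r : R := k0%:~R + \sum_(j < d) (k j)%:~R * alpha 0 j.
Let l (x : 'rV[R]_d) := \sum_(j < d) (k j)%:~R * x 0 j.

Definition susp_linear (x : X) : circle R :=
  \pi_(circle R) (l (repr (repr x).1) + r * (repr x).2).

Let lB x y : l (x - y) = l x - l y.
Proof.
by rewrite /l -sumrB; apply: eq_bigr => j _; rewrite !mxE mulrBr.
Qed.

Let l_int x y : \pi_(torus R d) x = \pi_(torus R d) y ->
  l x - l y \is a Num.int.
Proof.
move/(@quot_pi_eqP R 'rV[R]_d (@lattice R d)) => /mxOverP xy.
rewrite -lB; apply: rpred_sum => j _; apply: rpredM; first exact: intr_int.
exact: xy.
Qed.

Let homeo_iter_translate (n : int) x :
  homeo_iter f n (\pi_(torus R d) x) = \pi_(torus R d) (x + alpha *~ n).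
Proof.
elim: n => [|n IHn|n IHn]; first by rewrite mulr0z addr0.
  by rewrite -addn1 PoszD homeo_iter1 IHn mulrzDr addrA /= -torus_piD.
rewrite -addn1 PoszD opprD homeo_iterN1 IHn mulrzDr addrA /=.
apply: (addIr (\pi_(torus R d) alpha)).
by rewrite subrK -torus_piD mulrN1z subrK.
Qed.

(** Passing to another representative of the class changes the value by an integer: [l] is integral
    on the lattice, and [n] steps of the relation contribute [k0 * n] because [r - l alpha = k0]. *)
Lemma susp_linearE s x :
  susp_linear (susp_cover alpha (s, x)) = \pi_(circle R) (l x + r * s).
Proof.
rewrite /susp_linear.
have /asboolP[n] : susp_rel f (repr (susp_cover alpha (s, x)))
    (\pi_(torus R d) x, s).
  by have /eqmodP := reprK (susp_cover alpha (s, x)).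
case: (repr _) => w t /= [xw ->].
apply/circle_eqP.
have lx : l (repr w + alpha *~ n) - l x \is a Num.int.
  by apply: l_int; rewrite -homeo_iter_translate reprK xw.
have lw : l (repr w + alpha *~ n) = l (repr w) + (r - k0%:~R) * n%:~R.
  have -> : r - k0%:~R = l alpha by rewrite /r addrC addKr.
  rewrite /l mulr_suml -big_split; apply: eq_bigr => j _.
  by rewrite -[alpha *~ n]scaler_int !mxE mulrDr [n%:~R * _]mulrC mulrA.
rewrite (_ : _ - _ = l (repr w + alpha *~ n) - l x + k0%:~R * n%:~R).
  by rewrite rpredD// rpredM// intr_int.
by rewrite lw; ring.
Qed.

(** [quotient_continuous] removes the quotient by the suspension relation; in the torus factor,
    openness of the projection carries neighbourhoods down from the vector space. *)
Lemma susp_linear_continuous : continuous susp_linear.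
Proof.
apply/quotient_continuous => -[w s].
rewrite -(reprK w); set x := repr w.
pose u (p : R * 'rV[R]_d) := \pi_(circle R) (l p.2 + r * p.1).
have cu : continuous u.
  apply: (continuousT_comp _ (@pi_continuous _ (Quotient.quot (@int_pred R)))).
  move=> p; apply: cvgD.
    apply: (@cvg_big R _ +%R 0 xpredT (@add_continuous R)) => j _.
    apply: cvgM; first exact: cvg_cst.
    apply: (@continuous_comp _ _ _ snd (fun v : 'rV[R]_d => v 0 j) p).
      exact: cvg_snd.
    exact: coord_continuous.
  by apply: cvgM; [exact: cvg_cst|exact: cvg_fst].
move=> A /=; rewrite [X in nbhs X A]susp_linearE => uA.
have [[U V] /= [Us Vx] UV] := cu (s, x) A uA.
exists (\pi_(torus R d) @` V, U).
  by split => //; exact: (@nbhs_pi R 'rV[R]_d (@lattice R d)).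
move=> [_ t] /= [[y Vy <-] Ut].
by rewrite [susp_linear _]susp_linearE; exact: (UV (t, y)).
Qed.

Lemma susp_linear_rotation x : has_rotation_number susp_linear x r.
Proof.
have [[s v] ->] := susp_coverP x.
exists (fun t => l v + r * (s + t)).
  split.
    move=> t; apply: cvgD; first exact: cvg_cst.
    apply: cvgM; first exact: cvg_cst.
    by apply: cvgD; [exact: cvg_cst|exact: cvg_id].
  by move=> t; rewrite susp_flow_cover susp_linearE.
apply: (@cvg_div_id _ _ _ `|l v + r * s|) => t.
by rewrite mulrDr addrA addrK.
Qed.

End linear_maps.

(** * Computation of the range *)

Theorem theorem6p2 (R : realType) (d : nat) (alpha : 'rV[R]_d)
    (alpha_indep : rationally_independent alpha) :
  schwartzman_range (torus_rotation alpha) (torus_lebesgue R d) =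
  [set r : R | exists (k0 : int) (k : 'I_d -> int),
     r = k0%:~R + \sum_(j < d) (k j)%:~R * alpha 0 j].
Proof.
have class_eq (phi : suspension R (torus_rotation alpha) -> circle R) :
    continuous phi -> exists k0 (k : 'I_d -> int),
      let r := k0%:~R + \sum_(j < d) (k j)%:~R * alpha 0 j in
      (forall x, has_rotation_number phi x r) /\
      schwartzman (torus_lebesgue R d) (homotopy_class R phi) = r.
  move=> cphi; have [_ /homotopic_rotation_number[k0 [k /= phir]]] :=
    homotopy_class_refl cphi.
  exists k0, k; split => [x|]; first by have [] := phir x.
  (* Each [psi] in the class comes with its own integers; comparison at [phi], the common end of the
     homotopies, shows that the resulting numbers agree. *)
  apply: schwartzman_eq => // psi [_ /homotopic_rotation_number].
  move=> [k0' [k' phir']] x; have [psi1 psi2] := phir' x.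
  by rewrite (rotation_number_unique (phir x).1 psi1).
apply/seteqP; split=> [_ [_ [phi cphi <-] <-]|_ [k0 [k ->]]] /=.
  by have [k0 [k [_ ->]]] := class_eq _ cphi; exists k0, k.
have cphi := @susp_linear_continuous R d alpha k0 k.
exists (homotopy_class R (susp_linear k0 k)).
  by exists (susp_linear k0 k).
(* These integers may a priori differ from [k0] and [k]; the two sums agree as rotation numbers of
   the linear map at one point. *)
have [k0' [k' [phir ->]]] := class_eq _ cphi.
pose x := susp_cover alpha (0, 0).
exact: rotation_number_unique (phir x) (susp_linear_rotation k0 k x).
Qed.
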